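(* Let $G$ be a locally compact group with a local right action on a locally compact space $X$, defined on the open set $\Gamma\subseteq X\times G$. Let $f\in C_c(X)$ with support $C$. Then the set $$V_f=\{p\in G\mid (x,p^{-1})\in\Gamma\text{ for all }x\in C\}$$ is an (open) neighborhood of the identity in $G$.
   Context: Locally compact groups and spaces are Hausdorff. $e$ is the identity of $G$; a neighborhood of $e$ always means an open neighborhood. $C_c(X)$ is the space of continuous complex functions on $X$ with compact support; the support is the closure of the set where the function is non-zero. Local right action of $G$ on $X$: a continuous map $(x,p)\mapsto x\cdot p$ from an open subset $\Gamma\subseteq X\times G$ to $X$ such that (i) $(x,e)\in\Gamma$ and $x\cdot e=x$ for all $x\in X$; (ii) for $(x,p)\in\Gamma$ and $q\in G$: $(x,pq)\in\Gamma$ if and only if $(x\cdot p,q)\in\Gamma$, and in that case $x\cdot(pq)=(x\cdot p)\cdot q$. *)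

(* Defs.v *)
From HB Require Import structures.
From mathcomp Require Import all_boot all_order all_algebra.
From mathcomp Require Import all_classical all_reals all_analysis.
From mathcomp Require Import complex.
Import numFieldNormedType.Exports.

Set Implicit Arguments.
Unset Strict Implicit.
Unset Printing Implicit Defensive.

Local Open Scope classical_set_scope.
Local Open Scope ring_scope.
Local Open Scope complex_scope.

(* Multiplicative analogue of the library's TopologicalZmodule. *)
HB.structure Definition PreTopologicalGroup :=
  {G of Topological G & Group G}.

HB.mixin Record PreTopologicalGroup_isTopologicalGroup G
    & PreTopologicalGroup G := {
  mulg_continuous : continuous (fun xy : G * G => (xy.1 * xy.2)%g) ;
  invg_continuous : continuous (fun x : G => (x^-1)%g) }.

#[short(type="topologicalGroupType")]
HB.structure Definition TopologicalGroup :=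
  {G of PreTopologicalGroup G & PreTopologicalGroup_isTopologicalGroup G}.

Definition locally_compact_hausdorff (T : topologicalType) : Prop :=
  hausdorff_space T /\ locally_compact [set: T].

(* The partial map Gamma -> X is represented by a total function act; its
   values outside Gamma are arbitrary and unconstrained by the axioms, since
   {within Gamma, continuous _} only depends on the restriction to Gamma. *)
Record is_local_right_action (X : topologicalType) (G : topologicalGroupType)
    (Gamma : set (X * G)) (act : X * G -> X) : Prop := {
  lra_open : open Gamma ;
  lra_continuous : {within Gamma, continuous act} ;
  lra_dom1 : forall x, Gamma (x, 1%g) ;
  lra_act1 : forall x, act (x, 1%g) = x ;
  lra_domM : forall x p q, Gamma (x, p) ->
    (Gamma (x, (p * q)%g) <-> Gamma (act (x, p), q)) ;
  lra_actM : forall x p q, Gamma (x, p) -> Gamma (x, (p * q)%g) ->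
    act (x, (p * q)%g) = act (act (x, p), q) }.

Definition closed_support (R : realType) (X : topologicalType)
    (f : X -> R[i]) : set X :=
  closure [set x | f x != 0].

(* R[i] has no canonical topology in the library; the alias R[i]^o carries the
   one induced by the complex modulus. *)
Definition Cc (R : realType) (X : topologicalType) : set (X -> R[i]) :=
  [set f | continuous (f : X -> R[i]^o) /\ compact (closed_support f)].
Arguments Cc : clear implicits.

(* Main.v *)
Require Import Defs.
From mathcomp Require Import all_boot all_order all_algebra.
From mathcomp Require Import all_classical all_reals all_analysis.
From mathcomp Require Import complex.
Import numFieldNormedType.Exports.

(** The condition on [p] is that the slice [C * {p^-1}] lies in the open set
    [Gamma], where [C] is the support of [f]. Since [C] is compact, the tube
    lemma ([open_compact_slices]) says that the set of [q] with [C * {q}]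
    contained in [Gamma] is open; the set in question is its preimage under the
    continuous inversion, and it contains [1] because [Gamma] contains every
    [(x, 1)]. *)

Local Open Scope classical_set_scope.
Local Open Scope ring_scope.
Local Open Scope complex_scope.

(** The tube lemma: around a point [q] of the set, openness of [W] gives for
    each [x] in [K] a box around [(x, q)] inside [W], and compactness of [K]
    makes the second side of the box uniform in [x]. *)
Lemma open_compact_slices (X Y : topologicalType) (K : set X)
    (W : set (X * Y)) :
  compact K -> open W -> open [set q : Y | forall x, K x -> W (x, q)].
Proof.
move=> /compact_near_coveringP Kcov Wopen.
rewrite openE => q /= Kq.
apply: (Kcov Y (nbhs q) (fun y x => W (x, y))) => x Kx.
have : nbhs (x, q) W by apply: open_nbhs_nbhs; split=> //; exact: Kq.
by apply: filterS => -[].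
Qed.

Theorem proposition2p4 (R : realType)
  (G : topologicalGroupType) (hG : locally_compact_hausdorff G)
  (X : topologicalType) (hX : locally_compact_hausdorff X)
  (Gamma : set (X * G)) (act : X * G -> X)
  (hact : is_local_right_action Gamma act)
  (f : X -> R[i]) (hf : Cc R X f) :
  open_nbhs (1%g : G)
    [set p : G | forall x : X, closed_support f x -> Gamma (x, (p^-1)%g)].
Proof.
case: hf => _ Kcompact; split; last first.
  by move=> x _ /=; rewrite invg1; exact: lra_dom1 hact x.
have Uopen := open_compact_slices _ _ _ _ Kcompact (lra_open hact).
have /continuousP inv_open := @invg_continuous G.
exact: inv_open _ Uopen.
Qed.
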